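(* Fix $1\le p\le\infty$. Let $\alpha$ be irrational with $p$-continued fraction $\alpha=a_0+\frac{\varepsilon_1}{a_1+}\frac{\varepsilon_2}{a_2+}\frac{\varepsilon_3}{a_3+}\cdots$. Define $\mu_0=\alpha$, $\nu_0=0$, and for $m\ge1$ \[ \mu_m=\frac{\varepsilon_{m+1}}{a_{m+1}+}\;\frac{\varepsilon_{m+2}}{a_{m+2}+}\cdots,\qquad \nu_m=\frac{1}{a_m+}\;\frac{\varepsilon_m}{a_{m-1}+}\;\frac{\varepsilon_{m-1}}{a_{m-2}+}\cdots\frac{\varepsilon_2}{a_1}. \] Then $\delta_p(\alpha)=\limsup_{m\to\infty}\Delta_p\,D_p(\mu_m,\nu_m)$, where for $1\le p<\infty$ \[ D_p(u,v)=\frac{1}{1+uv}\left(\frac{(1-|u|^pv^p)^2}{(1-|u|^p)(1-v^p)}\right)^{1/p}, \] and $D_\infty(u,v)=(1+uv)^{-1}$.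
   Context: For $1\le p<\infty$ the $p$-norm is $F^{\langle p\rangle}(x,y)=(|x|^p+|y|^p)^{1/p}$, and $F^{\langle\infty\rangle}(x,y)=\max(|x|,|y|)$; for $t>0$ put $F_t(x,y)=F(t^{-1}x,ty)$. $\Delta_p$ is the minimal area of a parallelogram with one vertex at the origin and the other three on the boundary of $\{P:F^{\langle p\rangle}(P)<1\}$. For irrational $\alpha$, $\delta_p(\alpha)$ is the largest real number such that: if $c>\delta_p(\alpha)$ then for every sufficiently large real $t$ there are integers $a,q$, $q>0$, with $\Delta_p F^{\langle p\rangle}_t(q,a-\alpha q)^2<c$, while if $c<\delta_p(\alpha)$ there are arbitrarily large $t$ for which no such $a,q$ exist. A semi-regular continued fraction is $a_0+\frac{\varepsilon_1}{a_1+}\frac{\varepsilon_2}{a_2+}\cdots$ with $a_0\in\mathbb{Z}$, integers $a_m>0$, $\varepsilon_m=\pm1$, $a_m+\varepsilon_{m+1}\ge1$ for all $m\ge1$ and $a_m+\varepsilon_{m+1}\ge2$ for infinitely many $m$; its convergents are $a_0+\frac{\varepsilon_1}{a_1+}\cdots\frac{\varepsilon_m}{a_m}$, $m\ge0$. A rational $\frac{r}{q}$, $q>0$, is a best approximation to $\alpha$ with respect to a norm $F$ if for some $t>1$, $F_t(q,r-\alpha q)<F_t(s,r'-\alpha s)$ for all rationals $\frac{r'}{s}\ne\frac rq$. The $p$-continued fraction of $\alpha$ is the unique semi-regular continued fraction converging to $\alpha$ whose convergents are exactly the best approximations to $\alpha$ with respect to $F^{\langle p\rangle}$. *)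

(* Defs.v *)
From HB Require Import structures.
From mathcomp Require Import all_boot all_order all_algebra.
From mathcomp Require Import all_classical all_reals all_analysis.

Set Implicit Arguments.
Unset Strict Implicit.
Unset Printing Implicit Defensive.

Import Order.TTheory GRing.Theory Num.Theory.
Import numFieldNormedType.Exports.

Local Open Scope classical_set_scope.
Local Open Scope ring_scope.

Section Norms.
Context {R : realType}.

(* The value at -oo is junk: the exponent always satisfies 1 <= p. *)
Definition pnorm (p : \bar R) (x y : R) : R :=
  match p with
  | r%:E => (`|x| `^ r + `|y| `^ r) `^ r^-1
  | +oo%E => Num.max `|x| `|y|
  | -oo%E => 0
  end.

Definition scaled (F : R -> R -> R) (t x y : R) : R := F (t^-1 * x) (t * y).

Definition boundary (A : set (R * R)) : set (R * R) := closure A `\` A°.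

(* The parallelogram with vertices 0, P, P + Q, Q has area |det (P, Q)|. *)
Definition inscribed_areas (p : \bar R) : set R :=
  [set A | exists P Q : R * R,
     let B := boundary [set X : R * R | pnorm p X.1 X.2 < 1] in
     [/\ B P, B Q & B (P + Q)] /\
     P.1 * Q.2 - P.2 * Q.1 != 0 /\ A = `|P.1 * Q.2 - P.2 * Q.1|].

Definition Delta (p : \bar R) : R := inf (inscribed_areas p).

Definition approximable (p : \bar R) (alpha c t : R) : Prop :=
  exists a q : int, 0 < q /\
    Delta p * scaled (pnorm p) t q%:~R (a%:~R - alpha * q%:~R) ^+ 2 < c.

Definition delta_property (p : \bar R) (alpha d : R) : Prop :=
  (forall c, d < c -> \forall t \near +oo, approximable p alpha c t) /\
  (forall c, c < d -> forall T, exists2 t, T < t & ~ approximable p alpha c t).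

Definition is_delta (p : \bar R) (alpha d : R) : Prop :=
  delta_property p alpha d /\
  forall d', delta_property p alpha d' -> d' <= d.

(* Rationals are written r / q in lowest terms with q > 0. *)
Definition best_approximation (F : R -> R -> R) (alpha : R) (x : rat) : Prop :=
  let G t (y : rat) :=
    scaled F t (denq y)%:~R ((numq y)%:~R - alpha * (denq y)%:~R) in
  exists2 t : R, 1 < t & forall y : rat, y != x -> G t x < G t y.

End Norms.

Section ContinuedFractions.
Context {R : realType}.
Implicit Types a e : nat -> int.

(* a m and e m stand for a_m and epsilon_m; the value e 0 is never used. *)
Definition semi_regular a e : Prop :=
  [/\ forall m, (1 <= m)%N -> 0 < a m,
      forall m, (1 <= m)%N -> e m = 1 \/ e m = -1,
      forall m, (1 <= m)%N -> 1 <= a m + e m.+1 &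
      forall N, exists2 m, (N <= m)%N & 2 <= a m + e m.+1].

(* e_(m+1)/(a_(m+1) + e_(m+2)/(a_(m+2) + ... + e_(m+n)/a_(m+n))) *)
Fixpoint cf_tail a e (m n : nat) : R :=
  if n is n'.+1 then (e m.+1)%:~R / ((a m.+1)%:~R + cf_tail a e m.+1 n')
  else 0.

Definition convergent a e (m : nat) : R := (a 0)%:~R + cf_tail a e 0 m.

Definition is_pcf (p : \bar R) (alpha : R) a e : Prop :=
  [/\ semi_regular a e,
      convergent a e @ \oo --> alpha &
      forall x : rat, best_approximation (pnorm p) alpha x <->
                      exists m, convergent a e m = ratr x].

Definition mu (alpha : R) a e (m : nat) : R :=
  if m is 0 then alpha else limn (cf_tail a e m).

(* nu_m = 1/(a_m + e_m/(a_(m-1) + ... + e_2/a_1)); e 1 is multiplied by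
   nu 0 = 0. *)
Fixpoint nu a e (m : nat) : R :=
  if m is m'.+1 then ((a m)%:~R + (e m)%:~R * nu a e m')^-1 else 0.

Definition D (p : \bar R) (u v : R) : R :=
  match p with
  | r%:E => (1 + u * v)^-1 *
      ((1 - `|u| `^ r * v `^ r) ^+ 2 / ((1 - `|u| `^ r) * (1 - v `^ r))) `^ r^-1
  | +oo%E => (1 + u * v)^-1
  | -oo%E => 0
  end.

End ContinuedFractions.

(* Main.v *)
Require Import Defs.
From HB Require Import structures.
From mathcomp Require Import all_boot all_order all_algebra.
From mathcomp Require Import all_classical all_reals all_analysis.
From mathcomp Require Import ring lra zify.
Import Order.TTheory GRing.Theory Num.Theory.
Import numFieldNormedType.Exports.
Local Open Scope classical_set_scope.
Local Open Scope ring_scope.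

Set Implicit Arguments.
Unset Strict Implicit.
Unset Printing Implicit Defensive.

(** Let [p_m / q_m] be the convergents and [th_m = p_m - alpha q_m], so that
    [mu_m = - th_m / th_(m-1)] and [nu_m = q_(m-1) / q_m].  Two distinct best
    approximations, best at times [s < t], have increasing denominators and
    decreasing errors; since [|mu_m| <= 1], the [q_m] increase, the [|th_m|]
    decrease and the times at which the convergents are best increase to
    infinity.  The curves [t |-> F_t(q_(m-1), th_(m-1))] and
    [t |-> F_t(q_m, th_m)] cross at a single time [T_m], and the square of
    their common value there is [D_p(mu_m, nu_m)].

    Between [T_m] and [T_(m+1)] the quasiconvex curve of [p_m / q_m] stays
    below its values at the endpoints, whence [delta <= limsup].  Conversely
    no lattice point beats the common value at [T_m]: such a point would have
    [q < q_m] and [|th| < |th_(m-1)|], which leaves a single candidate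
    [(p_m - p_(m-1)) / (q_m - q_(m-1))]; it would then be a best approximation
    strictly between two consecutive convergents.  Dirichlet's theorem bounds
    the common values, so the limsup is finite. *)

(** * Comparison of values of [F_t]: monotonicity, quasiconvexity, crossings *)

Section ScaledNorms.
Context {R : realType}.
Implicit Types (p : \bar R) (r s t x y u v : R).

Lemma ltr_powR2 r x y : 0 < r -> 0 <= x -> 0 <= y ->
  (x `^ r < y `^ r) = (x < y).
Proof.
move=> r0 x0 y0; case: (ltP x y) => xy; first by rewrite gt0_ltr_powR ?nnegrE.
by apply/negbTE; rewrite -leNgt ge0_ler_powR ?nnegrE // ltW.
Qed.

Lemma pnorm_mono p x y x' y' : (1 <= p)%E -> `|x| <= `|x'| -> `|y| <= `|y'| ->
  pnorm p x y <= pnorm p x' y'.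
Proof.
case: p => [r| |]; last 2 first.
- by move=> _ xx yy /=; rewrite ge_max (le_max `|x|) (le_max `|y|) xx yy orbT.
- by [].
move=> p1 xx yy.
have r0 : 0 < r by rewrite (lt_le_trans ltr01) // -lee_fin.
apply: ge0_ler_powR; rewrite ?nnegrE ?addr_ge0 ?powR_ge0 ?invr_ge0 ?(ltW r0) //.
by apply: lerD; apply: ge0_ler_powR; rewrite ?nnegrE ?(ltW r0).
Qed.

Lemma pnorm_ge_abs p x y : (1 <= p)%E -> `|x| <= pnorm p x y.
Proof.
case: p => [r| |] //= p1; last by rewrite le_max lexx.
have r0 : 0 < r by rewrite (lt_le_trans ltr01) // -lee_fin.
have {1}-> : `|x| = (`|x| `^ r) `^ r^-1.
  by rewrite -powRrM divff ?gt_eqF // powRr1.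
apply: ge0_ler_powR; rewrite ?nnegrE ?addr_ge0 ?powR_ge0 ?invr_ge0 ?(ltW r0) //.
by rewrite lerDl powR_ge0.
Qed.

Lemma pnorm_ge0 p x y : (1 <= p)%E -> 0 <= pnorm p x y.
Proof. by move=> p1; apply: le_trans (pnorm_ge_abs x y p1). Qed.

Lemma scaled_mono p t x y x' y' : (1 <= p)%E -> 0 < t ->
  `|x| <= `|x'| -> `|y| <= `|y'| ->
  scaled (pnorm p) t x y <= scaled (pnorm p) t x' y'.
Proof.
move=> p1 t0 xx yy; apply: pnorm_mono => //.
  by rewrite !normrM ler_pM2l // gtr0_norm ?invr_gt0.
by rewrite !normrM ler_pM2l // gtr0_norm.
Qed.

Lemma scaled_finE r t x y : 0 < t ->
  scaled (pnorm r%:E) t x y =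
  ((t `^ r)^-1 * `|x| `^ r + t `^ r * `|y| `^ r) `^ r^-1.
Proof.
move=> t0; rewrite /scaled /= !normrM (powRM _ (normr_ge0 t) (normr_ge0 y)).
rewrite (powRM _ (normr_ge0 t^-1) (normr_ge0 x)) normfV (gtr0_norm t0).
by rewrite -{1}(powR_inv1 (ltW t0)) powRAC (powR_inv1 (powR_ge0 t r)).
Qed.

Lemma scaled_inftyE t x y : 0 < t ->
  scaled (pnorm +oo%E) t x y = Num.max (t^-1 * `|x|) (t * `|y|).
Proof.
by move=> t0; rewrite /scaled /= !normrM (gtr0_norm t0) (@gtr0_norm _ t^-1) // invr_gt0.
Qed.

Lemma scaled_fin_lt r t x y x' y' : 0 < r -> 0 < t ->
  (scaled (pnorm r%:E) t x y < scaled (pnorm r%:E) t x' y') =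
  ((t `^ r)^-1 * `|x| `^ r + t `^ r * `|y| `^ r <
   (t `^ r)^-1 * `|x'| `^ r + t `^ r * `|y'| `^ r).
Proof.
move=> r0 t0; rewrite !scaled_finE // ltr_powR2 ?invr_gt0 //;
  by rewrite addr_ge0 // mulr_ge0 ?invr_ge0 ?powR_ge0.
Qed.

(** Multiplying by [t^r] leaves both sides affine in [t^(2r)]. *)
Lemma scaled_fin_lt_sqr r t x y x' y' : 0 < r -> 0 < t ->
  (scaled (pnorm r%:E) t x y < scaled (pnorm r%:E) t x' y') =
  (`|x| `^ r + t `^ r ^+ 2 * `|y| `^ r < `|x'| `^ r + t `^ r ^+ 2 * `|y'| `^ r).
Proof.
move=> r0 t0; rewrite scaled_fin_lt //.
have u0 := powR_gt0 r t0.
rewrite -(ltr_pM2l u0) !mulrDr !mulrA divff ?gt_eqF // !mul1r -!expr2 //.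
Qed.

Lemma scaled_infty_lt_sqr t x y x' y' : 0 < t ->
  (scaled (pnorm +oo%E) t x y < scaled (pnorm +oo%E) t x' y') =
  (Num.max `|x| (t ^+ 2 * `|y|) < Num.max `|x'| (t ^+ 2 * `|y'|)).
Proof.
move=> t0; rewrite !scaled_inftyE // -(ltr_pM2l t0) !maxr_pMr ?ltW // !mulrA.
by rewrite divff ?gt_eqF // !mul1r -expr2.
Qed.

(** For finite [p], adding the two comparisons isolates the sign of [|y'|^r - |y|^r]; the comparison
    at [s] then orders [|x|] and [|x'|]. *)
Lemma scaled_lt_swap p s t x y x' y' : (1 <= p)%E -> 0 < s -> s < t ->
  scaled (pnorm p) s x y < scaled (pnorm p) s x' y' ->
  scaled (pnorm p) t x' y' < scaled (pnorm p) t x y ->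
  `|x| < `|x'| /\ `|y'| < `|y|.
Proof.
move=> + s0 st; have t0 := lt_trans s0 st.
case: p => [r| |] //= p1.
  have r0 : 0 < r by rewrite (lt_le_trans ltr01) // -lee_fin.
  move=> h1; rewrite (scaled_fin_lt_sqr x' y' x y r0 t0) => h2.
  move: h1 h2; rewrite (scaled_fin_lt_sqr x y x' y' r0 s0).
  rewrite -(ltr_powR2 r0 (normr_ge0 x) (normr_ge0 x')).
  rewrite -(ltr_powR2 r0 (normr_ge0 y') (normr_ge0 y)).
  have : s `^ r ^+ 2 < t `^ r ^+ 2.
    by rewrite ltr_pXn2r ?nnegrE ?powR_ge0 // ltr_powR2 // ltW.
  have : 0 < s `^ r ^+ 2 by rewrite exprn_gt0 // powR_gt0.
  move: (s `^ r ^+ 2) (t `^ r ^+ 2) => U V U0 UV h1 h2.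
  have B : `|y'| `^ r < `|y| `^ r.
    have : (V - U) * (`|y'| `^ r - `|y| `^ r) < 0 by lra.
    by rewrite pmulr_rlt0 ?subr_gt0 // subr_lt0.
  split=> //; nra.
rewrite !scaled_infty_lt_sqr //.
have : s ^+ 2 < t ^+ 2 by rewrite ltr_pXn2r ?nnegrE // ltW.
have : 0 < s ^+ 2 by rewrite exprn_gt0.
move: (s ^+ 2) (t ^+ 2) (normr_ge0 x) (normr_ge0 y) (normr_ge0 x') (normr_ge0 y').
move: `|x| `|y| `|x'| `|y'| => a b a' b' U V a0 b0 a'0 b'0 U0 UV h1 h2.
(* If [a' <= a], the right maximum at [s] is [U * b'], so [b < b']; then [V * b'] exceeds both [a]
   and [V * b]. *)
have aa : a < a'.
  rewrite ltNge; apply/negP => aa; move: h1 h2.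
  rewrite !gt_max !lt_max => /andP[/orP[h1|h1] h2]; first lra.
  have h3 : U * b < U * b' by case/orP: h2 => //; lra.
  have h4 : b < b' by rewrite -(ltr_pM2l U0).
  by move=> /andP[_ /orP[]]; nra.
split=> //; rewrite ltNge; apply/negP => bb; move: h2.
by rewrite gt_max !lt_max => /andP[/orP[]]; nra.
Qed.

(** For finite [p] the [r]-th power of the norm is [A / z + B * z] at [z = t^r]. A middle value
    above both ends would force [V * W * B < A < U * V * B], although [U <= W]. *)
Lemma scaled_quasiconvex p s t t' x y : (1 <= p)%E -> 0 < s ->
  s <= t -> t <= t' ->
  scaled (pnorm p) t x y <=
  Num.max (scaled (pnorm p) s x y) (scaled (pnorm p) t' x y).
Proof.
move=> + s0 st tt'; have t0 := lt_le_trans s0 st.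
have t'0 := lt_le_trans t0 tt'.
case: p => [r| |] //= p1; last first.
  rewrite !scaled_inftyE // ge_max; apply/andP; split.
    by rewrite 3!le_max ler_wpM2r // lef_pV2.
  by rewrite 3!le_max [t * _ <= t' * _]ler_wpM2r // !orbT.
have r0 : 0 < r by rewrite (lt_le_trans ltr01) // -lee_fin.
rewrite !scaled_finE // leNgt gt_max; apply/negP.
have ns z : 0 < z -> 0 <= (z `^ r)^-1 * `|x| `^ r + z `^ r * `|y| `^ r.
  by move=> z0; rewrite addr_ge0 // mulr_ge0 ?invr_ge0 ?powR_ge0.
have ri : 0 < r^-1 by rewrite invr_gt0.
case/andP=> h1; rewrite (ltr_powR2 ri (ns _ t'0) (ns _ t0)) => h2; move: h1.
rewrite (ltr_powR2 ri (ns _ s0) (ns _ t0)) => h1; move: h1 h2.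
have : s `^ r <= t `^ r by rewrite ge0_ler_powR ?nnegrE // ltW.
have : t `^ r <= t' `^ r by rewrite ge0_ler_powR ?nnegrE // ltW.
move: (powR_gt0 r s0) (powR_gt0 r t0) (powR_gt0 r t'0).
move: (powR_ge0 `|x| r) (powR_ge0 `|y| r).
move: (`|x| `^ r) (`|y| `^ r) (s `^ r) (t `^ r) (t' `^ r).
move=> A B U V W A0 B0 U0 V0 W0 VW UV h1 h2.
have k1 : A * (V - U) < U * V * (V - U) * B.
  rewrite -(ltr_pM2l (mulr_gt0 U0 V0)) !mulrDr in h1.
  have e1 : U * V * (U^-1 * A) = V * A by field; rewrite gt_eqF.
  have e2 : U * V * (V^-1 * A) = U * A by field; rewrite gt_eqF.
  rewrite e1 e2 in h1; lra.
have k2 : V * W * (W - V) * B < A * (W - V).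
  rewrite -(ltr_pM2l (mulr_gt0 V0 W0)) !mulrDr in h2.
  have e1 : V * W * (V^-1 * A) = W * A by field; rewrite gt_eqF.
  have e2 : V * W * (W^-1 * A) = V * A by field; rewrite gt_eqF.
  rewrite e1 e2 in h2; lra.
have UV' : 0 < V - U.
  by rewrite lt_neqAle subr_ge0 UV andbT eq_sym; apply: contraTneq k1 => ->; lra.
have VW' : 0 < W - V.
  by rewrite lt_neqAle subr_ge0 VW andbT eq_sym; apply: contraTneq k2 => ->; lra.
have l1 : A < U * V * B.
  by rewrite -(ltr_pM2r UV'); apply: lt_le_trans k1 _; rewrite mulrAC.
have l2 : V * W * B < A.
  by rewrite -(ltr_pM2r VW'); apply: le_lt_trans k2; rewrite mulrAC.
have : U * V * B <= V * W * B by rewrite ler_wpM2r // mulrC ler_wpM2l ?ltW //; lra.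
lra.
Qed.

(** The crossing for finite [p], with [A' = |x'|^r], [B = |y|^r], [U = |u|^r], [V = v^r],
    [W = T^r]. *)
Lemma sum_crossing (A' B U V W : R) : 0 < W -> 0 < A' -> 0 < B -> U < 1 -> V < 1 ->
  W ^+ 2 = A' * (1 - V) / (B * (1 - U)) ->
  W^-1 * (V * A') + W * B = W^-1 * A' + W * (U * B) /\
  (W^-1 * A' + W * (U * B)) ^+ 2 =
    A' * B * ((1 - U * V) ^+ 2 / ((1 - U) * (1 - V))).
Proof.
move=> W0 A0 B0 U1 V1 WE.
have W0' : W != 0 by rewrite gt_eqF.
have A0' : A' != 0 by rewrite gt_eqF.
have B0' : B != 0 by rewrite gt_eqF.
have U1' : 1 - U != 0 by rewrite subr_eq0 gt_eqF.
have V1' : 1 - V != 0 by rewrite subr_eq0 gt_eqF.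
split; apply/eqP; rewrite -subr_eq0; apply/eqP.
  rewrite (_ : _ - _ = W^-1 * (W ^+ 2 * (B * (1 - U)) - A' * (1 - V))); last by field.
  by rewrite WE divfK ?mulf_neq0 // subrr mulr0.
rewrite (_ : _ ^+ 2 = (A' + W ^+ 2 * (U * B)) ^+ 2 / W ^+ 2); last by field.
by rewrite WE; field; rewrite U1' B0' A0' V1'.
Qed.

(* With [v = |x| / |x'|] and [|u| = |y'| / |y|], the two curves
   [t |-> F_t(x, y)] and [t |-> F_t(x', y')] cross at
   [T^(2r) = (|x'|^r - |x|^r) / (|y|^r - |y'|^r)], or [T^2 = |x'| / |y|] for
   the maximum norm. *)
Lemma scaled_crossing p x y x' y' u v : (1 <= p)%E ->
  `|x| < `|x'| -> `|y'| < `|y| ->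
  0 <= v -> `|x| = v * `|x'| -> `|y'| = `|u| * `|y| ->
  (1 + u * v) * (`|x'| * `|y|) = 1 ->
  exists T, [/\ 0 < T,
    scaled (pnorm p) T x y = scaled (pnorm p) T x' y',
    scaled (pnorm p) T x' y' ^+ 2 = D p u v,
    forall s, 0 < s ->
      scaled (pnorm p) s x y < scaled (pnorm p) s x' y' -> s < T &
    forall s, 0 < s ->
      scaled (pnorm p) s x' y' < scaled (pnorm p) s x y -> T < s].
Proof.
move=> + xx yy v0 xv yu uv1.
have x'0 : 0 < `|x'| by apply: le_lt_trans xx.
have y0 : 0 < `|y| by apply: le_lt_trans yy.
have uvE : (1 + u * v)^-1 = `|x'| * `|y|.
  have uvn : 1 + u * v != 0.
    by apply/eqP => E; move: uv1; rewrite E mul0r => /esym/eqP; rewrite oner_eq0.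
  by apply: (mulfI uvn); rewrite divff // uv1.
case: p => [r p1|_|//].
  have r0 : 0 < r by rewrite (lt_le_trans ltr01) // -lee_fin.
  have v1 : v < 1 by rewrite -(ltr_pM2r x'0) -xv mul1r.
  have u1 : `|u| < 1 by rewrite -(ltr_pM2r y0) -yu mul1r.
  have A0 := powR_gt0 r x'0; have B0 := powR_gt0 r y0.
  have U1 : `|u| `^ r < 1.
    by rewrite -[ltRHS](congr1 (@^~ r) (powR1 R)) (ltr_powR2 r0 (normr_ge0 u) ler01).
  have V1 : v `^ r < 1.
    by rewrite -[ltRHS](congr1 (@^~ r) (powR1 R)) (ltr_powR2 r0 v0 ler01).
  have AE : `|x| `^ r = v `^ r * `|x'| `^ r by rewrite xv (powRM r v0 (normr_ge0 x')).
  have BE : `|y'| `^ r = `|u| `^ r * `|y| `^ r.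
    by rewrite yu (powRM r (normr_ge0 u) (normr_ge0 y)).
  set A' := `|x'| `^ r in AE A0; set B := `|y| `^ r in BE B0.
  set U := `|u| `^ r in U1 BE; set V := v `^ r in V1 AE.
  (* [K] is [T^(2r)] and its square root [W] is [T^r], hence the crossing time [W^(1/r)]. *)
  pose K := A' * (1 - V) / (B * (1 - U)).
  have K0 : 0 < K by rewrite divr_gt0 // mulr_gt0 // subr_gt0.
  have W0 : 0 < Num.sqrt K by rewrite sqrtr_gt0.
  have [E1 E2] := sum_crossing W0 A0 B0 U1 V1 (sqr_sqrtr (ltW K0)).
  set W := Num.sqrt K in W0 E1 E2.
  have WK : W ^+ 2 = K by exact: sqr_sqrtr (ltW K0).
  have T0 : 0 < W `^ r^-1 := powR_gt0 r^-1 W0.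
  have TW : (W `^ r^-1) `^ r = W.
    by rewrite -powRrM mulVf ?gt_eqF // (powRr1 (ltW W0)).
  have KE : K * (B * (1 - U)) = A' * (1 - V).
    by rewrite /K divfK // mulf_neq0 ?gt_eqF // subr_gt0.
  have cmp s : 0 < s -> (s `^ r ^+ 2 < K) = (s < W `^ r^-1).
    move=> s0; rewrite -WK ltr_pXn2r ?nnegrE ?(ltW W0) ?powR_ge0 //.
    by rewrite -{1}TW (ltr_powR2 r0 (ltW s0) (ltW T0)).
  have cmp' s : 0 < s -> (K < s `^ r ^+ 2) = (W `^ r^-1 < s).
    move=> s0; rewrite -WK ltr_pXn2r ?nnegrE ?(ltW W0) ?powR_ge0 //.
    by rewrite -{1}TW (ltr_powR2 r0 (ltW T0) (ltW s0)).
  have BU0 : 0 < B * (1 - U) by rewrite mulr_gt0 // subr_gt0.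
  exists (W `^ r^-1); split; first exact: T0.
  - by rewrite !(scaled_finE _ _ _ T0) TW AE BE E1.
  - rewrite (scaled_finE _ _ _ T0) TW BE.
    rewrite -(powR_mulrn 2 (powR_ge0 _ _)) powRAC powR_mulrn; last first.
      by rewrite addr_ge0 // ?mulr_ge0 ?powR_ge0 ?invr_ge0 ?ltW.
    rewrite E2 /D uvE powRM; last 2 first.
    + by rewrite mulr_ge0 // ltW.
    + by rewrite divr_ge0 ?sqr_ge0 // mulr_ge0 // subr_ge0 ltW.
    (* The [r]-th root of [A' * B] is [|x'| * |y|], the prefactor of [D] by [uvE]. *)
    rewrite (powRM _ (ltW A0) (ltW B0)) /A' /B -!powRrM divff ?gt_eqF //.
    by rewrite (powRr1 (normr_ge0 x')) (powRr1 (normr_ge0 y)).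
  - move=> s s0; rewrite (scaled_fin_lt_sqr x y x' y' r0 s0) AE BE -(cmp _ s0) -/A' -/B => h.
    by rewrite -(ltr_pM2r BU0) KE; lra.
  - move=> s s0; rewrite (scaled_fin_lt_sqr x' y' x y r0 s0) AE BE -(cmp' _ s0) -/A' -/B => h.
    by rewrite -(ltr_pM2r BU0) KE; lra.
have q0 : 0 < `|x'| / `|y| by rewrite divr_gt0.
have sqT := sqr_sqrtr (ltW q0).
have T0 : 0 < Num.sqrt (`|x'| / `|y|) by rewrite sqrtr_gt0.
exists (Num.sqrt (`|x'| / `|y|)).
set T := Num.sqrt _ in sqT T0 *.
have T2y : T ^+ 2 * `|y| = `|x'| by rewrite sqT divfK ?gt_eqF.
(* At [T] the dominant coordinates agree: [T |y|] for the first point, [T^-1 |x'|] for the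
   second. *)
have TE : T * `|y| = T^-1 * `|x'| by rewrite -T2y; field; rewrite gt_eqF.
have E2 : Num.max (T^-1 * `|x'|) (T * `|y'|) = T^-1 * `|x'|.
  by rewrite max_l // -TE ler_pM2l // ltW.
split=> //.
- rewrite !scaled_inftyE // E2 TE max_r // ler_pM2l ?invr_gt0 //.
  exact: ltW.
- by rewrite scaled_inftyE // E2 /D uvE expr2 -{1}TE; field; rewrite gt_eqF.
- move=> s s0; rewrite scaled_infty_lt_sqr // gt_max => /andP[_].
  rewrite lt_max => /orP[h|h].
    have : s ^+ 2 < T ^+ 2 by rewrite -(ltr_pM2r y0) T2y.
    by rewrite ltr_pXn2r ?nnegrE // ltW.
  have := ltW yy; rewrite -(ler_pM2l (exprn_gt0 2 s0)) => h'.
  by have := lt_le_trans h h'; rewrite ltxx.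
- move=> s s0; rewrite scaled_infty_lt_sqr // gt_max => /andP[+ _].
  rewrite lt_max => /orP[h|h]; first by have := lt_trans h xx; rewrite ltxx.
  have : T ^+ 2 < s ^+ 2 by rewrite -(ltr_pM2r y0) T2y.
  by rewrite ltr_pXn2r ?nnegrE // ltW.
Qed.

End ScaledNorms.

(** * Continuants, convergents and tails of semi-regular continued fractions *)

Section Continuants.
Variables (a e : nat -> int).

(* [continuant 1 0 m] is [(q_m, q_(m-1))] and [continuant (a 0) 1 m] is
   [(p_m, p_(m-1))]. *)
Fixpoint continuant (x y : int) (m : nat) : int * int :=
  if m is m'.+1 then
    let c := continuant x y m' in (a m * c.1 + e m * c.2, c.1)
  else (x, y).

Definition cf_num m := (continuant (a 0) 1 m).1.
Definition cf_den m := (continuant 1 0 m).1.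

Lemma continuant_det m : (forall k, (1 <= k)%N -> e k = 1 \/ e k = -1) ->
  `|(continuant (a 0) 1 m).1 * (continuant 1 0 m).2 -
    (continuant (a 0) 1 m).2 * (continuant 1 0 m).1| = 1.
Proof.
move=> He; elim: m => [|m IH] /=; first by rewrite mulr0 mulr1 sub0r.
rewrite (_ : _ - _ = - e m.+1 *
  ((continuant (a 0) 1 m).1 * (continuant 1 0 m).2 -
    (continuant (a 0) 1 m).2 * (continuant 1 0 m).1)); last by ring.
by rewrite normrM IH mulr1; case: (He m.+1 isT) => ->.
Qed.

Hypothesis sr : semi_regular a e.

Lemma cf_den_gt0 m : 0 < cf_den m.
Proof.
case: sr => Ha He Hae _.
(* Positivity of [q_m] alone does not survive a step with [e = -1], so [q_m + e_(m+1) q_(m-1) > 0]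
   joins the induction. *)
suff [//] : 0 < (continuant 1 0 m).1 /\
    0 < (continuant 1 0 m).1 + e m.+1 * (continuant 1 0 m).2.
elim: m => [|m [IH1 IH2]] /=; first by split; rewrite ?mulr0 ?addr0.
have := Ha m.+1 isT; have := Hae m.+1 isT; split; nia.
Qed.

Lemma cf_detS m :
  `|cf_num m.+1 * cf_den m - cf_num m * cf_den m.+1| = 1.
Proof. by case: sr => _ He _ _; exact: (continuant_det m.+1 He). Qed.

(** The determinant of consecutive fractions is a Bezout relation. *)
Lemma cf_fraction_coprime m : coprime `|cf_num m| `|cf_den m|.
Proof.
have := cf_detS m.
move: (cf_num m.+1) (cf_den m.+1) (cf_num m) (cf_den m).
move=> p q p' q' h; rewrite -[coprime _ _]/(coprimez p' q').
apply/coprimezP.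
have [h1|h1] : p * q' - p' * q = 1 \/ p * q' - p' * q = -1 by lia.
  exists (- q, p); rewrite /=; lia.
exists (q, - p); rewrite /=; lia.
Qed.

Definition cf_fraction m : rat := (cf_num m)%:~R / (cf_den m)%:~R.

Lemma numq_cf_fraction m : numq (cf_fraction m) = cf_num m.
Proof.
by rewrite coprimeq_num ?cf_fraction_coprime // gtr0_sg ?mul1r ?cf_den_gt0.
Qed.

Lemma denq_cf_fraction m : denq (cf_fraction m) = cf_den m.
Proof.
rewrite coprimeq_den ?cf_fraction_coprime // gt_eqF ?cf_den_gt0 //.
by rewrite gtr0_norm ?cf_den_gt0.
Qed.

Lemma cf_fractionS_neq m : cf_fraction m.+1 != cf_fraction m.
Proof.
apply/eqP => E; have := cf_detS m.
by rewrite -!numq_cf_fraction -!denq_cf_fraction E subrr.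
Qed.

Context {R : realType}.

(** A negative [x] occurs only with [e m.+1 = -1], and then semi-regularity forces [a m >= 2]. *)
Lemma cf_tail_shift_ge1 m (x : R) : (1 <= m)%N -> -1 <= x ->
  (e m.+1 = 1 -> 0 <= x) -> 1 <= (a m)%:~R + x.
Proof.
case: sr => Ha He Hae _ m1 x1 x0.
have [h|h] := He m.+1 isT.
  have := x0 h; have : 1 <= (a m)%:~R :> R; last lra.
  by rewrite (ler_int _ 1); have := Ha m m1; lia.
have : 2 <= (a m)%:~R :> R; last lra.
by rewrite (ler_int _ 2); have := Hae m m1; rewrite h; lia.
Qed.

Lemma cf_tail_bounds m n :
  -1 <= (cf_tail a e m n : R) <= 1 /\ (e m.+1 = 1 -> 0 <= cf_tail a e m n :> R).
Proof.
elim: n m => [|n IH] m /=; first by split=> //; lra.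
have [/andP[b0 _] b1] := IH m.+1.
have den1 := cf_tail_shift_ge1 (isT : (1 <= m.+1)%N) b0 b1.
have den0 : 0 < ((a m.+1)%:~R + cf_tail a e m.+1 n)^-1 :> R.
  by rewrite invr_gt0; lra.
have dle : ((a m.+1)%:~R + cf_tail a e m.+1 n)^-1 <= 1 :> R.
  by rewrite invf_le1 //; lra.
case: sr => _ He _ _.
have [->|->] := He m.+1 isT; split; rewrite ?mul1r ?mulN1r //; lra.
Qed.

(** The convergent is a Moebius transform of its tail, with continuants as coefficients; the
    identity is multiplied out to avoid a quotient. *)
Lemma convergent_split m n :
  convergent a e (m + n) * (((continuant 1 0 m).1)%:~R +
    ((continuant 1 0 m).2)%:~R * cf_tail a e m n) =
  ((continuant (a 0) 1 m).1)%:~R +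
    ((continuant (a 0) 1 m).2)%:~R * cf_tail a e m n :> R.
Proof.
elim: m n => [|m IH] n; first by rewrite /= mul0r addr0 mulr1 mul1r.
have := IH n.+1; rewrite addnS -addSn; move: (convergent _ _ _) => c /=.
have [/andP[b0 _] b1] := cf_tail_bounds m.+1 n.
have := cf_tail_shift_ge1 (isT : (1 <= m.+1)%N) b0 b1.
set z := _ + _ => z1 h; have z0 : z != 0 by rewrite gt_eqF //; lra.
have tz : cf_tail a e m.+1 n = z - (a m.+1)%:~R by rewrite /z addrC addKr.
rewrite tz !(intrD, intrM); move: h.
move: z0 {tz z1}; move: z (a m.+1)%:~R (e m.+1)%:~R => z A E z0.
move: (continuant 1 0 m).1%:~R (continuant 1 0 m).2%:~R => Q Q'.
move: (continuant (a 0) 1 m).1%:~R (continuant (a 0) 1 m).2%:~R => P P' h.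
rewrite [LHS](_ : _ = z * (c * (Q + Q' * (E / z)))); last by field.
by rewrite h; field.
Qed.

Lemma convergentE m : convergent a e m = ratr (cf_fraction m) :> R.
Proof.
have := convergent_split m 0; rewrite addn0 /= !mulr0 !addr0 => h.
rewrite fmorph_div /= !ratr_int -h mulfK // intr_eq0 gt_eqF //.
exact: cf_den_gt0.
Qed.

Lemma nuE m : nu a e m = ((continuant 1 0 m).2)%:~R / (cf_den m)%:~R :> R.
Proof.
elim: m => [|m IH] /=; first by rewrite mul0r.
have Q0 : (cf_den m)%:~R != 0 :> R by rewrite intr_eq0 gt_eqF // cf_den_gt0.
have Q1 : (cf_den m.+1)%:~R != 0 :> R by rewrite intr_eq0 gt_eqF // cf_den_gt0.
rewrite IH; move: Q0 Q1; rewrite /cf_den /= intrD !intrM.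
move: ((continuant 1 0 m).1%:~R : R) ((continuant 1 0 m).2%:~R : R).
by move=> Q Q' Q0 Q1; field; rewrite Q0 Q1.
Qed.

Variable alpha : R.

Definition cf_err m : R := (cf_num m)%:~R - alpha * (cf_den m)%:~R.

Hypothesis irr : irrational alpha.

Lemma cf_err_neq0 m : cf_err m != 0.
Proof.
apply/eqP => /eqP; rewrite subr_eq0 => /eqP h; apply: irr.
exists (cf_fraction m) => //.
rewrite fmorph_div /= !ratr_int h mulfK // intr_eq0 gt_eqF //.
exact: cf_den_gt0.
Qed.

Hypothesis cvga : convergent a e @ \oo --> alpha.

(** Solving [convergent_split] for the tail gives a quotient of two expressions [p - c q] with [c]
    tending to [alpha]; irrationality makes the limiting denominator nonzero. *)
Lemma cf_tail_cvg m : cf_tail a e m.+1 n @[n --> \oo] --> - cf_err m.+1 / cf_err m.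
Proof.
pose c n : R := convergent a e (n + m.+1).
have cc : c @ \oo --> alpha by rewrite cvg_shiftn.
pose N n : R := (cf_num m.+1)%:~R - c n * (cf_den m.+1)%:~R.
pose M n : R := (cf_num m)%:~R - c n * (cf_den m)%:~R.
have cN : N @ \oo --> cf_err m.+1.
  by apply: cvgB; [exact: cvg_cst|apply: cvgM => //; exact: cvg_cst].
have cM : M @ \oo --> cf_err m.
  by apply: cvgB; [exact: cvg_cst|apply: cvgM => //; exact: cvg_cst].
have : (fun n => - N n / M n) @ \oo --> - cf_err m.+1 / cf_err m.
  by apply: cvgM; [exact: cvgN|apply: cvgV => //; exact: cf_err_neq0].
apply: cvg_trans; apply: near_eq_cvg.
have /cvgr_neq0 /(_ (cf_err_neq0 m)) Mn := cM.
near=> n.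
have M0 : M n != 0 by near: n.
have := convergent_split m.+1 n; rewrite addnC -/(c n) => h.
apply: (mulIf M0); rewrite divfK // /N /M.
move: h; rewrite /cf_num /cf_den /=.
move: (cf_tail _ _ _ _) => t h; lra.
Unshelve. all: by end_near. Qed.

Lemma muE m : mu alpha a e m.+1 = - cf_err m.+1 / cf_err m.
Proof. by rewrite /mu; apply/cvg_lim => //; exact: cf_tail_cvg. Qed.

(** The finite tails lie in [[-1, 1]], hence so does their limit. *)
Lemma cf_err_le m : `|cf_err m.+1| <= `|cf_err m|.
Proof.
have : `|- cf_err m.+1 / cf_err m| <= 1.
  apply: (cvgr_to_le (cvg_norm (cf_tail_cvg (m := m)))).
  by near=> n; rewrite ler_norml; case: (cf_tail_bounds m.+1 n).
by rewrite normrM normrN normfV ler_pdivrMr ?mul1r // normr_gt0 cf_err_neq0.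
Unshelve. all: by end_near. Qed.

End Continuants.

(** * Dirichlet approximation, limits superior, lattice points in a box *)

Section Auxiliary.
Context {R : realType}.

(** Pigeonhole: [N + 1] fractional parts fall in [N] boxes of length [1 / N], with [N] the integer
    part of [T]. The bound 2 comes from [T <= 2 N]. *)
Lemma dirichlet_approximation (alpha T : R) : 1 <= T ->
  exists a q : int, [/\ 0 < q, q%:~R <= T & T * `|a%:~R - alpha * q%:~R| <= 2].
Proof.
move=> T1; have T0 : 0 <= T by apply: le_trans T1.
have /andP[NT TN] := truncn_itv T0; set N := Num.trunc T in NT TN.
have N0 : (0 < N)%N.
  by rewrite -(ltr_nat R) -(ltrD2r 1) add0r natr1; exact: le_lt_trans TN.
pose fl (k : nat) := Num.floor (k%:R * alpha).
pose fr (k : nat) : R := k%:R * alpha - (fl k)%:~R.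
have fr01 k : 0 <= fr k < 1.
  have /andP[] := floor_itv (k%:R * alpha); rewrite intrD -/(fl k) /fr => h1 h2.
  by apply/andP; split; lra.
have N0' : 0 < N%:R :> R by rewrite ltr0n.
have Nfr0 k : 0 <= N%:R * fr k by rewrite mulr_ge0 //; case/andP: (fr01 k).
have trN (k : nat) : (Num.trunc (N%:R * fr k)%R < N)%N.
  rewrite -(ltr_nat R); have /andP[h _] := truncn_itv (Nfr0 k).
  apply: le_lt_trans h _; rewrite -[ltRHS]mulr1 ltr_pM2l //.
  by case/andP: (fr01 k).
have /injectivePn[i [j ij fij]] : ~~ injectiveb (fun k : 'I_N.+1 => Ordinal (trN k)).
  by apply/injectiveP => /leq_card; rewrite !card_ord ltnn.
wlog lij : i j ij fij / (i < j)%N.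
  move=> W; case: (ltngtP i j) => h; first exact: (W i j).
    by apply: (W j i) => //; rewrite eq_sym.
  by move: ij; rewrite (val_inj h) eqxx.
exists (fl j - fl i), (j%:Z - i%:Z); split.
- by rewrite subr_gt0 ltz_nat.
- apply: le_trans NT; rewrite [leRHS]pmulrn ler_int.
  by have := ltn_ord j; lia.
have d1 : N%:R * `|fr i - fr j| < 1.
  have [h1 h2] := (truncn_itv (Nfr0 i), truncn_itv (Nfr0 j)).
  have E : Num.trunc (N%:R * fr i) = Num.trunc (N%:R * fr j) := congr1 val fij.
  rewrite -{1}(ger0_norm (ltW N0')) -normrM mulrBr ltr_norml.
  rewrite E in h1; move: h1 h2; rewrite -natr1 => /andP[? ?] /andP[? ?].
  by apply/andP; split; lra.
rewrite (_ : _ - _ = fr i - fr j); last by rewrite /fr !rmorphB /= !pmulrn; lra.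
have := normr_ge0 (fr i - fr j); move: `|_| d1 => z d1 z0.
have : T <= 2 * N%:R.
  by have : 1 <= N%:R :> R; [rewrite ler1n|rewrite -natr1 in TN; lra].
by nra.
Qed.

Lemma lt_limn_esup_near (f : nat -> R) (c : R) :
  (limn_esup (EFin \o f) < c%:E)%E -> exists N, forall n, (N <= n)%N -> f n < c.
Proof.
move=> /ereal_inf_lt[_ [V [N _ NV] <-] h]; exists N => n Nn.
rewrite -lte_fin; apply: le_lt_trans h; apply: ereal_sup_ubound.
by exists n => //; exact: NV.
Qed.

Lemma limn_esup_gt_frequently (f : nat -> R) (c : R) (N : nat) :
  (c%:E < limn_esup (EFin \o f))%E -> exists2 n, (N <= n)%N & c < f n.
Proof.
move=> h.
have /ereal_sup_gt[_ [n Nn <-]] : (c%:E <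
    ereal_sup [set (EFin \o f) x | x in [set n | (N <= n)%N]])%E.
  apply: lt_le_trans h _; apply: ereal_inf_lbound.
  by exists [set n | (N <= n)%N] => //; exact: nbhs_infty_ge.
by rewrite lte_fin => cn; exists n.
Qed.

Lemma limn_esup_fin_num (f : nat -> R) (l u : R) (N : nat) :
  (forall n, (N <= n)%N -> l <= f n <= u) ->
  limn_esup (EFin \o f) \is a fin_num.
Proof.
move=> lu; rewrite fin_numE -ltNye -ltey; apply/andP; split.
  apply: (@lt_le_trans _ _ l%:E); first exact: ltNyr.
  apply: le_ereal_inf_tmp => _ [V [M _ MV] <-].
  apply: le_ereal_sup_tmp; exists (f (maxn M N))%:E.
    by exists (maxn M N) => //; apply: MV; rewrite /= leq_maxl.
  by rewrite lee_fin; case/andP: (lu _ (leq_maxr M N)).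
apply: (@le_lt_trans _ _ u%:E); last exact: ltry.
apply: (@le_trans _ _ (ereal_sup [set (EFin \o f) x | x in [set n | (N <= n)%N]])).
  apply: ereal_inf_lbound.
  by exists [set n | (N <= n)%N] => //; exact: nbhs_infty_ge.
apply: ge_ereal_sup => _ [n /= Nn <-]; rewrite lee_fin.
by case/andP: (lu _ Nn).
Qed.

Lemma Delta_ge0 (p : \bar R) : 0 <= Delta p.
Proof.
(* By convention the infimum of the empty set is 0. *)
rewrite /Delta; have [->|/set0P ne] := eqVneq (inscribed_areas p) set0.
  by rewrite inf0.
by apply: lb_le_inf => // _ [P [Q [_ [_ ->]]]].
Qed.

(** For [c] strictly between [d] and a larger [d'], the two halves of the property contradict each
    other. *)
Lemma is_delta_of_property (p : \bar R) (alpha d : R) :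
  delta_property p alpha d -> is_delta p alpha d.
Proof.
move=> dp; split=> // d' [_ h']; rewrite leNgt; apply/negP => dd'.
have [c dc cd'] : exists2 c, d < c & c < d'.
  by exists ((d + d') / 2); lra.
have [M [_ hM]] := dp.1 _ dc.
by have [t /hM] := h' _ cd' M.
Qed.

(* Writing [(b, q) = i (P', Q') + j (P, Q)] by Cramer's rule, the size
   conditions force [j = - i]. *)
Lemma lattice_box (P Q P' Q' b q : int) (th th' alpha : R) :
  `|P' * Q - P * Q'| = 1 -> 0 < Q -> Q < Q' -> 0 < q -> q < Q' ->
  th = P%:~R - alpha * Q%:~R -> th' = P'%:~R - alpha * Q'%:~R ->
  `|th'| < `|th| -> `|b%:~R - alpha * q%:~R| < `|th| ->
  exists i : int, b = i * (P' - P) /\ q = i * (Q' - Q).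
Proof.
move=> det Q0 QQ' q0 qQ' thE th'E thth bq.
pose dl := P' * Q - P * Q'.
have dl2 : dl * dl = 1.
  by have [->|->] : dl = 1 \/ dl = -1 by move: det; rewrite -/dl; lia.
pose i := dl * (b * Q - q * P); pose j := dl * (P' * q - Q' * b).
have bE : b = i * P' + j * P.
  by rewrite -[LHS]mul1r -dl2 /i /j /dl; ring.
have qE : q = i * Q' + j * Q.
  by rewrite -[LHS]mul1r -dl2 /i /j /dl; ring.
(* Here [j th] is the error of [(b, q)] minus [i th'], so [|j| |th| < (|i| + 1) |th|]. *)
have ji : `|j| <= `|i|.
  have th0 : 0 < `|th| by apply: le_lt_trans thth.
  suff : `|j|%:~R < (`|i| + 1)%:~R :> R by rewrite ltr_int; lia.
  rewrite -(ltr_pM2r th0) intrD mulrDl mul1r !intr_norm -normrM.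
  have -> : j%:~R * th = (b%:~R - alpha * q%:~R) - i%:~R * th'.
    by rewrite thE th'E {1}bE {1}qE !(intrD, intrM); ring.
  apply: le_lt_trans (ler_normB _ _) _; rewrite addrC normrM.
  by apply: ler_ltD => //; rewrite ler_wpM2l // ltW.
(* Positivity of [q] excludes [i <= 0]; for [i >= 1], any [j > - i] would give [q >= Q']. *)
have jiE : j = - i.
  move: qE q0 qQ' ji Q0 QQ'; clear; move: i j => i j -> *.
  have [i0|i0|i0] := ltgtP i 0; nia.
by exists i; rewrite bE qE jiE; split; ring.
Qed.

End Auxiliary.

(** * Best approximations, crossing times and the value of [delta] *)

Section Main.
Context {R : realType}.
Variables (p : \bar R) (alpha : R) (a e : nat -> int).
Hypothesis p1 : (1 <= p)%E.
Hypothesis irr : irrational alpha.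
Hypothesis pcf : is_pcf p alpha a e.

Let sr : semi_regular a e. Proof. by case: pcf. Qed.
Let cvga : convergent a e @ \oo --> alpha. Proof. by case: pcf. Qed.

Let q m : R := (cf_den a e m)%:~R.
Let th m := cf_err a e alpha m.
Let G t m := scaled (pnorm p) t (q m) (th m).
Let H t (y : rat) :=
  scaled (pnorm p) t (denq y)%:~R ((numq y)%:~R - alpha * (denq y)%:~R).

Let HE t m : H t (cf_fraction a e m) = G t m.
Proof. by rewrite /H numq_cf_fraction // denq_cf_fraction. Qed.

Let best_at t m := forall y, y != cf_fraction a e m -> G t m < H t y.

Lemma best_time m : exists t, 1 < t /\ best_at t m.
Proof.
have [_ _ /(_ (cf_fraction a e m)) [_]] := pcf.
have ex : exists k, convergent a e k = ratr (cf_fraction a e m) :> R.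
  by exists m; exact: convergentE.
move=> /(_ ex)[t t1 ht]; exists t; split=> // y yx.
by rewrite -HE; exact: ht.
Qed.

Let qgt0 m : 0 < q m. Proof. by rewrite ltr0z; exact: cf_den_gt0. Qed.
Let normq m : `|q m| = q m. Proof. exact: gtr0_norm. Qed.

(** Times in the reverse order would make the errors increase strictly, against [cf_err_le]; at
    equal times each fraction would beat the other. *)
Lemma best_time_step s s' m : 1 < s -> 1 < s' -> best_at s m -> best_at s' m.+1 ->
  [/\ s < s', cf_den a e m < cf_den a e m.+1 & `|th m.+1| < `|th m|].
Proof.
move=> s1 s'1 /(_ _ (cf_fractionS_neq sr m)).
rewrite HE => h1 /(_ (cf_fraction a e m)).
rewrite eq_sym => /(_ (cf_fractionS_neq sr m)); rewrite HE => h2.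
have [ss'|s's|ss'] := ltgtP s s'.
- have [qq tt] := scaled_lt_swap p1 (lt_trans ltr01 s1) ss' h1 h2.
  by split=> //; move: qq; rewrite !normq ltr_int.
- have [_] := scaled_lt_swap p1 (lt_trans ltr01 s'1) s's h2 h1.
  by move/lt_le_trans => /(_ _ (cf_err_le sr irr cvga m)); rewrite ltxx.
- by move: h2; rewrite -ss' => /(lt_trans h1); rewrite ltxx.
Qed.

Lemma cf_den_lt m : cf_den a e m < cf_den a e m.+1.
Proof.
have [[s [s1 bs]] [s' [s'1 bs']]] := (best_time m, best_time m.+1).
by case: (best_time_step s1 s'1 bs bs').
Qed.

Lemma cf_err_lt m : `|th m.+1| < `|th m|.
Proof.
have [[s [s1 bs]] [s' [s'1 bs']]] := (best_time m, best_time m.+1).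
by case: (best_time_step s1 s'1 bs bs').
Qed.

Lemma cf_den_homo : {homo cf_den a e : m n / (m <= n)%N >-> m <= n}.
Proof.
by apply: homo_leq => // [y x z|m]; [exact: le_trans|exact/ltW/cf_den_lt].
Qed.

Lemma cf_den_ge m : m%:Z < cf_den a e m.
Proof. by elim: m => // m IH; have := cf_den_lt m; lia. Qed.

(** The indices are shifted by one: this is [T_(m+1)] of the overview. *)
Lemma crossing_time m : exists T, [/\ 0 < T, G T m = G T m.+1,
  G T m.+1 ^+ 2 = D p (mu alpha a e m.+1) (nu a e m.+1),
  forall s, 0 < s -> G s m < G s m.+1 -> s < T &
  forall s, 0 < s -> G s m.+1 < G s m -> T < s].
Proof.
have th0 : th m != 0 by exact: cf_err_neq0.
have q0 : q m.+1 != 0 by rewrite gt_eqF.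
have uE : mu alpha a e m.+1 = - th m.+1 / th m by exact: muE.
have vE : nu a e m.+1 = q m / q m.+1 by rewrite nuE.
have v0 : 0 <= nu a e m.+1 :> R by rewrite vE divr_ge0 ?ltW.
have qq : q m < q m.+1 by rewrite ltr_int cf_den_lt.
have tt := cf_err_lt m.
have u1 : `|mu alpha a e m.+1| < 1.
  by rewrite uE normrM normrN normfV ltr_pdivrMr ?mul1r // normr_gt0.
have v1 : nu a e m.+1 < 1 :> R by rewrite vE ltr_pdivrMr ?mul1r.
apply: scaled_crossing => //.
- by rewrite !normq.
- by rewrite !normq vE divfK.
- by rewrite uE normrM normrN normfV divfK // normr_eq0.
have uv : 0 <= 1 + mu alpha a e m.+1 * nu a e m.+1.
  by move: u1; rewrite ltr_norml => /andP[]; nra.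
(* The product is [q_(m+1) th_m - q_m th_(m+1)], a determinant from which [alpha] cancels. *)
rewrite -[X in X * _](ger0_norm uv) -!normrM uE vE.
rewrite [X in `|X|](_ : _ = - (cf_num a e m.+1 * cf_den a e m -
    cf_num a e m * cf_den a e m.+1)%:~R).
  by rewrite normrN -intr_norm cf_detS.
have E : (1 + - th m.+1 / th m * (q m / q m.+1)) * (q m.+1 * th m) =
   q m.+1 * th m - q m * th m.+1 by field; rewrite th0 q0.
by rewrite E /th /cf_err /q; ring.
Qed.

Lemma crossing_minimal m s s' T y : 1 < s -> s < T -> T < s' ->
  best_at s m -> best_at s' m.+1 -> G T m = G T m.+1 -> G T m.+1 <= H T y.
Proof.
move=> s1 sT Ts' bs bs' GT; rewrite leNgt; apply/negP => Hy.
have s0 := lt_trans ltr01 s1; have T0 := lt_trans s0 sT.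
(* Such a [z] loses to convergent [m] at [s] and to convergent [m + 1] at [s'] but beats both at
   [T]; the two swaps bound its denominator and error as [lattice_box] requires. *)
have box z : H T z < G T m.+1 ->
    [/\ q m < (denq z)%:~R, denq z < cf_den a e m.+1 &
     z = (cf_num a e m.+1 - cf_num a e m)%:~R /
         (cf_den a e m.+1 - cf_den a e m)%:~R].
  move=> Hz.
  have zm : z != cf_fraction a e m.
    by apply: contraTneq Hz => ->; rewrite HE GT ltxx.
  have zm' : z != cf_fraction a e m.+1.
    by apply: contraTneq Hz => ->; rewrite HE ltxx.
  have Hz' : H T z < G T m by rewrite GT.
  have [k1 k2] := scaled_lt_swap p1 s0 sT (bs _ zm) Hz'.
  have [k3 k4] := scaled_lt_swap p1 T0 Ts' Hz (bs' _ zm').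
  have dz : `|(denq z)%:~R| = (denq z)%:~R :> R by rewrite gtr0_norm // ltr0z denq_gt0.
  rewrite !normq dz in k1 k3.
  have k3' : denq z < cf_den a e m.+1 by rewrite -(ltr_int R).
  have [i [bE qE]] := lattice_box (cf_detS sr m) (cf_den_gt0 sr m) (cf_den_lt m)
    (denq_gt0 z) k3' erefl erefl (cf_err_lt m) k2.
  split=> //; rewrite -[LHS]divq_num_den bE qE !intrM -mulf_div divff ?mul1r //.
  by rewrite intr_eq0; apply: contraTneq (denq_gt0 z) => i0; rewrite qE i0 mul0r.
have [qy yq yE] := box _ Hy.
(* A rational doing no worse than [y] at [T] would satisfy [box] too, hence equal [y]. *)
have bay : best_approximation (pnorm p) alpha y.
  exists T => [|z zy]; first exact: lt_trans sT.
  rewrite -/(H T y) -/(H T z) ltNge; apply/negP => zle.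
  have [_ _ zE] := box _ (le_lt_trans zle Hy).
  by move: zy; rewrite zE yE eqxx.
have [_ _ /(_ y) [/(_ bay) [k] +] _] := pcf.
rewrite convergentE // => /fmorph_inj ky.
move: qy yq; rewrite -ky denq_cf_fraction // ltr_int.
(* Denominators of convergents increase, so none lies strictly between two consecutive ones. *)
case: (leqP k m) => km.
  by have := cf_den_homo km => /le_lt_trans h /h; rewrite ltxx.
by move=> _; have := cf_den_homo km => /lt_le_trans h /h; rewrite ltxx.
Qed.

(** Passes from the integer pairs of [approximable] to reduced fractions: removing a common factor
    does not increase [F_t]. *)
Lemma scaled_reduced t (b d : int) : 0 < t -> 0 < d -> exists y,
  H t y <= scaled (pnorm p) t d%:~R (b%:~R - alpha * d%:~R).
Proof.
move=> t0 d0; pose y : rat := b%:~R / d%:~R; exists y.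
have d0' : d%:~R != 0 :> rat by rewrite intr_eq0 gt_eqF.
have E : numq y * d = b * denq y.
  apply: (@intr_inj rat); by rewrite !intrM numqE mulrAC {1}/y divfK.
have /dvdzP[k kE] : (denq y %| d)%Z.
  by rewrite -(@Gauss_dvdzr _ (numq y)) ?E ?dvdz_mull // coprimez_sym; exact: coprime_num_den.
have bE : b = k * numq y.
  apply: (mulIf (denq_neq0 y)); rewrite -E kE; ring.
have k1 : 1 <= k by have := denq_gt0 y; nia.
have k1' : 1 <= `|k%:~R| :> R.
  by rewrite ger0_norm ?(ler_int _ 1) // ler0z; lia.
apply: scaled_mono => //.
  by rewrite kE intrM normrM ler_peMl.
rewrite kE bE !intrM mulrCA -mulrBr normrM ler_peMl //.
Qed.

Lemma best_times : exists s : nat -> R,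
  forall m, [/\ 1 < s m, best_at (s m) m & s m < s m.+1].
Proof.
have [s hs] := choice best_time; exists s => m.
have [s1 bs] := hs m; have [s'1 bs'] := hs m.+1.
by split=> //; case: (best_time_step s1 s'1 bs bs').
Qed.

Lemma best_times_unbounded (s : nat -> R) :
  (forall m, 1 < s m /\ best_at (s m) m) -> forall M, exists m, M < s m.
Proof.
move=> hs M; apply: contrapT => nex.
have sM m : s m <= M by rewrite leNgt; apply/negP => Mm; apply: nex; exists m.
have M1 : 1 < M by apply: lt_le_trans (sM 0%N); case: (hs 0%N).
have M0 : 0 < M by apply: lt_trans M1.
(* [C] bounds [G t 0] for [1 < t <= M], and [m] is chosen so that [M * C < m < q_m], while being
   best at a time up to [M] would force [q_m <= M * C]. *)
pose C := pnorm p (q 0) (M * th 0).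
pose m := (Num.trunc (M * C)).+1.
have C0 : 0 <= M * C := mulr_ge0 (ltW M0) (pnorm_ge0 _ _ p1).
have [s1 bs] := hs m; have s0 : 0 < s m by apply: lt_trans s1.
have neq : cf_fraction a e 0 != cf_fraction a e m.
  apply/eqP => /(congr1 denq); rewrite !denq_cf_fraction // => E.
  have := cf_den_lt 0; rewrite E; apply/negP; rewrite -leNgt.
  exact: cf_den_homo.
have := bs _ neq; rewrite HE => h.
have qm : (s m)^-1 * q m <= G (s m) m.
  rewrite -{1}(normq m) -[X in X * _]gtr0_norm ?invr_gt0 // -normrM.
  exact: pnorm_ge_abs.
have GC : G (s m) 0 <= C.
  apply: pnorm_mono => //.
    by rewrite normrM ler_piMl // gtr0_norm ?invr_gt0 // invf_le1 // ltW.
  by rewrite !normrM ler_wpM2r // !gtr0_norm.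
have : q m <= M * C.
  have : (s m)^-1 * q m <= C by apply: le_trans qm (le_trans (ltW h) GC).
  rewrite mulrC ler_pdivrMr // => k; apply: le_trans k _.
  by rewrite mulrC ler_wpM2r // pnorm_ge0.
have /andP[_ k] := truncn_itv C0.
move=> /le_lt_trans /(_ k); rewrite -/m /q pmulrn ltr_int.
by rewrite ltNge (ltW (cf_den_ge m)).
Qed.

Lemma delta_is_limsup : exists d : R, is_delta p alpha d /\
  d%:E = limn_esup (fun m => (Delta p * D p (mu alpha a e m) (nu a e m))%:E).
Proof.
have [s hs] := best_times.
have s1 m : 1 < s m by case: (hs m).
have bs m : best_at (s m) m by case: (hs m).
have [T hT] := choice crossing_time.
(* Crossing times interlace the best times: [s m < T m < s m.+1]. *)
have sT m : s m < T m.
  have [_ _ _ h _] := hT m; apply: h; first exact: lt_trans (s1 m).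
  by have := bs m _ (cf_fractionS_neq sr m); rewrite HE.
have Ts m : T m < s m.+1.
  have [_ _ _ _ h] := hT m; apply: h; first exact: lt_trans (s1 m.+1).
  by rewrite -(HE _ m); apply: bs; rewrite eq_sym cf_fractionS_neq.
have T0 m : 0 < T m by case: (hT m).
have T1 m : 1 < T m by apply: lt_trans (sT m).
have TT : {homo T : m n / (m <= n)%N >-> m <= n}.
  apply: homo_leq => // [y x z|m]; first exact: le_trans.
  by apply: ltW; apply: lt_trans (Ts m) (sT m.+1).
have Tunb M : exists m, M < T m.
  have [|m Mm] := best_times_unbounded (s := s) _ M; first by move=> m.
  by exists m; exact: lt_trans (sT m).
have GE m : G (T m) m = G (T m) m.+1 by case: (hT m).
have GD m : G (T m) m.+1 ^+ 2 = D p (mu alpha a e m.+1) (nu a e m.+1).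
  by case: (hT m).
have G0 t m : 0 <= G t m by apply: pnorm_ge0.
have Gmin m (b d : int) : 0 < d ->
    G (T m) m.+1 <= scaled (pnorm p) (T m) d%:~R (b%:~R - alpha * d%:~R).
  move=> d0; have [y] := scaled_reduced b (T0 m) d0; apply: le_trans.
  exact: (crossing_minimal y (s1 m) (sT m) (Ts m) (bs m) (bs m.+1) (GE m)).
pose f m := Delta p * D p (mu alpha a e m) (nu a e m).
have D0 : 0 <= Delta p := Delta_ge0 p.
(* Index 0 is left out since [mu 0 = alpha] and [nu 0 = 0] come from no crossing. Dirichlet at [T m]
   gives coordinates at most 1 and 2, hence the bound. *)
have fbd n : (1 <= n)%N -> 0 <= f n <= Delta p * pnorm p 1 2 ^+ 2.
  case: n => // m _; rewrite /f -GD; apply/andP; split.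
    by rewrite mulr_ge0 // sqr_ge0.
  rewrite ler_wpM2l // lerXn2r ?nnegrE ?pnorm_ge0 //.
  have [b [d [d0 dT bd]]] := dirichlet_approximation alpha (ltW (T1 m)).
  apply: le_trans (Gmin m b d d0) _; apply: pnorm_mono => //.
    rewrite normr1 gtr0_norm; last by rewrite mulr_gt0 ?invr_gt0 ?ltr0z.
    by rewrite mulrC ler_pdivrMr // mul1r.
  by rewrite normrM (gtr0_norm (T0 m)) (ger0_norm (ler0n _ 2)).
have fin := limn_esup_fin_num fbd.
set L := limn_esup _ in fin.
have LE : (fine L)%:E = L by rewrite fineK.
exists (fine L); split; last exact: LE.
apply: is_delta_of_property; split=> [c Lc|c cL M].
  have /lt_limn_esup_near[N hN] : (limn_esup (EFin \o f) < c%:E)%E.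
    by rewrite -/L -LE lte_fin.
  apply: filterS (nbhs_pinfty_ge (num_real (T N))) => t Nt.
  (* The least such [k] is some [m + 1], so [T m <= t < T m.+1] and convergent [m + 1] serves at
     [t]. *)
  have ex : exists k, t < T k := Tunb t.
  case: (ex_minnP ex) => k tk kmin.
  have Nk : (N < k)%N.
    rewrite ltnNge; apply/negP => /TT kN.
    by have := lt_le_trans tk kN; rewrite ltNge Nt.
  case: k tk kmin Nk => // m tm mmin Nm.
  have mt : T m <= t.
    by rewrite leNgt; apply/negP => /mmin; rewrite ltnn.
  exists (cf_num a e m.+1), (cf_den a e m.+1); split; first exact: cf_den_gt0.
  rewrite -/(cf_err a e alpha m.+1) -/(G t m.+1).
  have := scaled_quasiconvex (q m.+1) (th m.+1) p1 (T0 m) mt (ltW tm).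
  rewrite -/(G t m.+1) -/(G (T m) m.+1) -/(G (T m.+1) m.+1) GE.
  (* Both end values are crossing values, giving [f m.+1] at [T m] and, through [GE], [f m.+2] at
     [T m.+1]. *)
  have mono k : G t m.+1 <= G (T k) k.+1 -> (N <= k.+1)%N ->
      Delta p * G t m.+1 ^+ 2 < c.
    move=> h Nk; apply: le_lt_trans (hN _ Nk); rewrite /f -GD.
    by rewrite ler_wpM2l // lerXn2r ?nnegrE.
  by rewrite le_max => /orP[/mono|/mono]; apply; lia.
have [K MK] := Tunb M.
(* [K.+1] absorbs the shift between [f m.+1] and [T m]: it yields [K <= m], hence [M < T m]. *)
have [|n Kn cn] := @limn_esup_gt_frequently _ f c K.+1.
  by rewrite -/L -LE lte_fin.
case: n Kn cn => // m Km cm.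
exists (T m); first by apply: lt_le_trans MK _; exact: TT.
move=> [b [d [d0]]]; apply/negP; rewrite -leNgt; apply: le_trans (ltW cm) _.
rewrite /f -GD ler_wpM2l // lerXn2r ?nnegrE ?pnorm_ge0 //.
exact: Gmin.
Qed.

End Main.

Theorem theorem6 (R : realType) (p : \bar R) (alpha : R) (a e : nat -> int) :
  (1 <= p)%E ->
  irrational alpha ->
  is_pcf p alpha a e ->
  exists d : R, is_delta p alpha d /\
    d%:E = limn_esup (fun m => (Delta p * D p (mu alpha a e m) (nu a e m))%:E).
Proof. exact: delta_is_limsup. Qed.
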